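(* Let $\overline{d}$ denote the average degree of the input graph. There exists an $\alpha$-erasure-resilient $\varepsilon$-tester for connectedness of graphs with average degree $\overline{d}$ (given to the tester) that has 1-sided error, has query and time complexity $$O\Big(\frac{1}{(\varepsilon - \alpha)^2 \cdot \overline{d}} \cdot \min\Big\{\frac{1}{(\varepsilon-\alpha) \cdot \overline{d}^2},\,1 \Big\} \Big),$$ and works for every $\varepsilon \in (0,2/\overline{d})$ and every $\alpha \in [0,\varepsilon)$.
   Context: Graphs are simple and undirected, on a vertex set $V$ with $n=|V|$, represented by adjacency lists. For $\alpha\in[0,1]$, an $\alpha$-erased graph is the concatenation of the adjacency lists of a simple undirected graph $(V,E)$ in which at most $2\alpha|E|$ entries have been replaced by a special symbol $\bot$ (erased). A completion of an $\alpha$-erased graph $G$ is the adjacency-list representation of a simple undirected graph on $V$ that coincides with $G$ on all nonerased entries (list lengths unchanged). $m$ denotes half the total length of all adjacency lists, $\deg(u)$ the length of the adjacency list of $u$, and $\overline{d}=2m/n$. An algorithm accesses $G$ via degree queries (given $v$, return $\deg(v)$) and neighbor queries (given $(v,i)$, return the $i$-th entry of the adjacency list of $v$, possibly $\bot$). $G$ is connected if some completion of $G$ is connected; $G$ is $\varepsilon$-far from connected if every completion of $G$ differs in at least $\varepsilon m$ edges from every connected graph. An $\alpha$-erasure-resilient $\varepsilon$-tester for connectedness gets $\alpha,\varepsilon$ and query access to an $\alpha$-erased graph $G$, accepts with probability at least $2/3$ if $G$ is connected, and rejects with probability at least $2/3$ if $G$ is $\varepsilon$-far from connected; 1-sided error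 means connected inputs are accepted with probability 1.
   Formalization: The time bound is O(max{1, bound}) rather than O(bound): for one edge on n vertices with ε near 2/d̄ the stated bound tends to 0, while any run takes at least one step. The query bound is as stated, and for average degree at least 1 the time bounds agree. *)

(* Defs.v *)
From mathcomp Require Import all_boot all_order all_algebra.
From mathcomp Require Import reals.

Set Implicit Arguments.
Unset Strict Implicit.
Unset Printing Implicit Defensive.
Import Order.TTheory GRing.Theory Num.Theory.

(** * Erased graphs on the vertex set 'I_n *)

Definition adj_lists (n : nat) := 'I_n -> seq 'I_n.

(** The entry [None] is the erasure symbol. *)
Definition erased_lists (n : nat) := 'I_n -> seq (option 'I_n).

Definition simple_graph n (A : adj_lists n) : Prop :=
  [/\ forall u, uniq (A u),
      forall u, u \notin A u &
      forall u v, (v \in A u) = (u \in A v)].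

Definition edges n (A : adj_lists n) : {set {set 'I_n}} :=
  [set [set u; v] | u : 'I_n, v : 'I_n in A u].

Definition connected_graph n (A : adj_lists n) : Prop :=
  forall u v, connect (fun x y => y \in A x) u v.

(** [all2] also forces the two lists to have the same length. *)
Definition completion n (G : erased_lists n) (A : adj_lists n) : Prop :=
  simple_graph A /\
  forall u, all2 (fun e v => (e == None) || (e == Some v)) (G u) (A u).

Definition num_erased n (G : erased_lists n) : nat :=
  \sum_(u < n) count_mem None (G u).

Definition half_length (R : realType) n (G : erased_lists n) : R :=
  ((\sum_(u < n) size (G u))%N%:R / 2)%R.

Definition avg_degree (R : realType) n (G : erased_lists n) : R :=
  (2 * half_length R G / n%:R)%R.

(** The underlying unerased graph [A] is in particular a completion. *)
Definition alpha_erased (R : realType) (alpha : R) n (G : erased_lists n) :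
    Prop :=
  (0 <= alpha <= 1)%R /\
  exists A, completion G A /\
    ((num_erased G)%:R <= 2 * alpha * #|edges A|%:R)%R.

Definition erased_connected n (G : erased_lists n) : Prop :=
  exists A, completion G A /\ connected_graph A.

Definition edge_dist n (A B : adj_lists n) : nat :=
  #|(edges A :\: edges B) :|: (edges B :\: edges A)|.

Definition far_from_connected (R : realType) (eps : R) n
    (G : erased_lists n) : Prop :=
  forall A B, completion G A -> simple_graph B -> connected_graph B ->
    (eps * half_length R G <= (edge_dist A B)%:R)%R.

(** * Randomized RAM programs with query access to an erased graph

  The memory consists of the cells [a[i]], for [a] (an array name fixed in the
  program text) and [i] (computed at run time) natural numbers; all cells
  initially contain 0, and scalar variables are the cells [a[0]].  The only
  integer arithmetic is addition and (truncated) subtraction, so that words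
  cannot blow up and unit cost is a reasonable measure of time.  The real
  parameters can only be used in comparisons: there is no rounding. *)

Inductive nexpr : Type :=
| Const of nat
| NumVertices
| Read of nat & nexpr
| Add of nexpr & nexpr
| Sub of nexpr & nexpr.

Inductive rexpr : Type :=
| OfNat of nexpr
| AvgDegree
| Eps
| Alpha
| RAdd of rexpr & rexpr
| RSub of rexpr & rexpr
| RMul of rexpr & rexpr.

Inductive test : Type :=
| Less of rexpr & rexpr
| Not of test
| And of test & test.

(** In [Store], [Sample], [DegQuery], [NbrQuery] the first two arguments
  designate the cell that receives the result. *)
Inductive cmd : Type :=
| Store of nat & nexpr & nexpr
| Sample of nat & nexpr
| DegQuery of nat & nexpr & nexpr
| NbrQuery of nat & nexpr & nexpr & nexpr
| Seq of cmd & cmd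
| If of test & cmd & cmd
| While of test & cmd.

Record params (R : realType) :=
  Params { p_deg : R; p_eps : R; p_alpha : R }.

(** [tape] is the supply of independent uniform vertices not yet consumed. *)
Record state (n : nat) := State {
  mem : nat -> nat -> nat;
  tape : seq 'I_n;
  queries : nat }.

Fixpoint neval n (s : state n) (e : nexpr) : nat :=
  match e with
  | Const k => k
  | NumVertices => n
  | Read a i => mem s a (neval s i)
  | Add e1 e2 => neval s e1 + neval s e2
  | Sub e1 e2 => neval s e1 - neval s e2
  end.

Fixpoint reval (R : realType) (p : params R) n (s : state n) (e : rexpr) : R :=
  match e with
  | OfNat k => (neval s k)%:R
  | AvgDegree => p_deg p
  | Eps => p_eps p
  | Alpha => p_alpha p
  | RAdd e1 e2 => reval p s e1 + reval p s e2
  | RSub e1 e2 => reval p s e1 - reval p s e2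
  | RMul e1 e2 => reval p s e1 * reval p s e2
  end%R.

Fixpoint teval (R : realType) (p : params R) n (s : state n) (b : test) :
    bool :=
  match b with
  | Less e1 e2 => (reval p s e1 < reval p s e2)%R
  | Not b1 => ~~ teval p s b1
  | And b1 b2 => teval p s b1 && teval p s b2
  end.

Definition upd (M : nat -> nat -> nat) (a i x : nat) : nat -> nat -> nat :=
  fun a' i' => if (a' == a) && (i' == i) then x else M a' i'.

(** Oracle answers; [insub k] is the vertex numbered [k], if there is one.
  Neighbor positions start at 0; vertex [v] is returned as [v.+1], an erased
  entry (or an invalid query) as 0. *)
Definition deg_answer n (G : erased_lists n) (k : nat) : nat :=
  if insub k is Some v then size (G v) else 0.

Definition nbr_answer n (G : erased_lists n) (k i : nat) : nat :=
  if insub k is Some v then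
    if nth None (G v) i is Some u then (val u).+1 else 0
  else 0.

(** A configuration is the stack of commands that remain to be executed
  together with the current state. *)
Definition config (n : nat) := (seq cmd * state n)%type.

Definition step (R : realType) (p : params R) n (G : erased_lists n)
    (x : config n) : config n :=
  let: (k, s) := x in
  let: State M w q := s in
  match k with
  | [::] => x
  | Store a i e :: k' =>
      (k', State (upd M a (neval s i) (neval s e)) w q)
  | Sample a i :: k' =>
      if w is v :: w' then (k', State (upd M a (neval s i) (val v)) w' q)
      else (k', s)
  | DegQuery a i e :: k' =>
      (k', State (upd M a (neval s i) (deg_answer G (neval s e))) w q.+1)
  | NbrQuery a i e j :: k' =>
      (k', State (upd M a (neval s i)
                    (nbr_answer G (neval s e) (neval s j))) w q.+1)
  | Seq c1 c2 :: k' => ([:: c1, c2 & k'], s)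
  | If b c1 c2 :: k' => ((if teval p s b then c1 else c2) :: k', s)
  | While b c :: k' =>
      (if teval p s b then [:: c, While b c & k'] else k', s)
  end.

(** The configuration after [t] steps, with random vertices [w]. *)
Definition run (R : realType) (p : params R) n (G : erased_lists n)
    (P : cmd) (t : nat) (w : seq 'I_n) : config n :=
  iter t (step p G) ([:: P], State (fun _ _ => 0) w 0).

Definition halted n (x : config n) : bool := nilp x.1.

(** The verdict is read from the cell [0[0]]. *)
Definition accepting n (x : config n) : bool := halted x && (mem x.2 0 0 == 1).
Definition rejecting n (x : config n) : bool := halted x && (mem x.2 0 0 != 1).

(** Probability of an event over the choice of [t] independent uniform
  vertices; [t] steps consume at most [t] of them. *)
Definition prob (R : realType) n t (E : t.-tuple 'I_n -> bool) : R :=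
  (#|[set w | E w]|%:R / (n ^ t)%N%:R)%R.

Definition accept_prob (R : realType) (p : params R) n (G : erased_lists n)
    (P : cmd) (t : nat) : R :=
  prob R (fun w : t.-tuple 'I_n => accepting (run p G P t w)).

Definition reject_prob (R : realType) (p : params R) n (G : erased_lists n)
    (P : cmd) (t : nat) : R :=
  prob R (fun w : t.-tuple 'I_n => rejecting (run p G P t w)).

(** Worst case over the random choices: at most [t] steps, [q] queries. *)
Definition runs_within (R : realType) (p : params R) n (G : erased_lists n)
    (P : cmd) (t q : nat) : Prop :=
  forall w : t.-tuple 'I_n,
    halted (run p G P t w) /\ queries (run p G P t w).2 <= q.

(** [P], run for [t] steps, is an [alpha]-erasure-resilient [eps]-tester for
  connectedness of graphs on ['I_n] of average degree [d]. *)
Definition connectedness_tester (R : realType) (P : cmd) (t n : nat)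
    (d eps alpha : R) : Prop :=
  forall G : erased_lists n, alpha_erased alpha G -> avg_degree R G = d ->
    let p := Params d eps alpha in
    (erased_connected G -> (2 / 3 <= accept_prob p G P t)%R) /\
    (far_from_connected eps G -> (2 / 3 <= reject_prob p G P t)%R).

Definition one_sided (R : realType) (P : cmd) (t n : nat)
    (d eps alpha : R) : Prop :=
  forall G : erased_lists n, alpha_erased alpha G -> avg_degree R G = d ->
    erased_connected G -> accept_prob (Params d eps alpha) G P t = 1%R.

Definition complexity_bound (R : realType) (d eps alpha : R) : R :=
  (1 / ((eps - alpha) ^+ 2 * d) *
     Num.min (1 / ((eps - alpha) * d ^+ 2)) 1)%R.

(* Main.v *)
Require Import Defs.
From mathcomp Require Import all_boot all_order all_algebra.
From mathcomp Require Import reals.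
From mathcomp Require Import zify ring lra.
Import Order.TTheory GRing.Theory Num.Theory.

(** Write [gap = eps - alpha] and [beta = gap * d].  A graph that is
  [eps]-far from connected has more than [eps * m] components, of which at most
  [alpha * m] contain two or more erased entries; at least [n * beta / 4] of the
  other ones have at most [8 / beta] vertices and total degree at most [8 / gap].
  Such a component contains a vertex from which it is explored entirely along
  nonerased entries, and it is then recognized as a component of every
  completion: the edges leaving a set with at most one hidden entry and an
  even total degree are even in number and at most one.  Hence [8 / beta]
  random starting vertices suffice, and a search can be stopped when the total
  degree exceeds
  [(8 / beta) ^ 2] or [8 / gap].  If [d < 1]
  there are isolated vertices and no query is needed. *)

Set Implicit Arguments.
Unset Strict Implicit.
Unset Printing Implicit Defensive.

(** * The tester *)

(** [Queue[0 .. Reached)] lists the vertices reached in the current round, the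
  first [Front] of them already scanned; [Seen[v]] is the last round in which
  [v] was reached, so that nothing has to be erased between rounds. *)
Local Notation Verdict := 0 (only parsing).
Local Notation Round := 1 (only parsing).
Local Notation Total := 2 (only parsing).
Local Notation Erased := 3 (only parsing).
Local Notation Parity := 4 (only parsing).
Local Notation Front := 5 (only parsing).
Local Notation Reached := 6 (only parsing).
Local Notation Todo := 7 (only parsing).
Local Notation Answer := 8 (only parsing).
Local Notation Queue := 9 (only parsing).
Local Notation Seen := 10 (only parsing).

Definition load a := Read a (Const 0).
Definition assign a e := Store a (Const 0) e.
Definition nless e1 e2 := Less (OfNat e1) (OfNat e2).
Definition num k := OfNat (Const k).
Definition gap := RSub Eps Alpha.
Definition beta := RMul gap AvgDegree.

(** [Total] is at most both [(8 / beta) ^ 2] and [8 / gap], written with products because real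
    expressions have no division. *)
Definition within : test :=
  And (Not (Less (num 64) (RMul (RMul (OfNat (load Total)) beta) beta)))
      (Not (Less (num 8) (RMul (OfNat (load Total)) gap))).

(** [Todo] is dead wherever [skip] is used. *)
Definition skip := assign Todo (Const 0).

Definition mark e :=
  Seq (Store Seen e (load Round))
 (Seq (Store Queue (load Reached) e)
      (assign Reached (Add (load Reached) (Const 1)))).

Definition scan_entry :=
  Seq (assign Todo (Defs.Sub (load Todo) (Const 1)))
 (Seq (NbrQuery Answer (Const 0) (Read Queue (load Front)) (load Todo))
 (Seq (assign Parity (Defs.Sub (Const 1) (load Parity)))
      (If (nless (Const 0) (load Answer))
          (If (nless (Read Seen (Defs.Sub (load Answer) (Const 1))) (load Round))
              (mark (Defs.Sub (load Answer) (Const 1)))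
              (assign Answer (Const 0)))
          (assign Erased (Add (load Erased) (Const 1)))))).

Definition scan_list := While (nless (Const 0) (load Todo)) scan_entry.

(** The degree is added to [Total] before any entry is read, so a vertex of too large degree costs
    one degree query and its list stays unread. *)
Definition scan_vertex :=
  Seq (DegQuery Todo (Const 0) (Read Queue (load Front)))
 (Seq (assign Total (Add (load Total) (load Todo)))
 (Seq (If within scan_list skip)
      (assign Front (Add (load Front) (Const 1))))).

Definition explore :=
  While (And (nless (load Front) (load Reached)) within) scan_vertex.

(** [within] is tested again because [explore] also stops once the bound is exceeded; [Erased],
    [Parity] and [Reached] then do not account for the unread list. *)
Definition found :=
  And within
 (And (nless (load Erased) (Const 2))
 (And (nless (load Parity) (Const 1)) (nless (load Reached) NumVertices))).

Definition one_round :=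
  Seq (assign Round (Add (load Round) (Const 1)))
 (Seq (Sample Queue (Const 0))
 (Seq (assign Total (Const 0))
 (Seq (assign Erased (Const 0))
 (Seq (assign Parity (Const 0))
 (Seq (assign Front (Const 0))
 (Seq (assign Reached (Const 1))
 (Seq (Store Seen (Read Queue (Const 0)) (load Round))
 (Seq explore
      (If found (assign Verdict (Const 0)) skip))))))))).

(** The guard, tested with [Round] counted from 0, yields the ceiling of [8 / beta] rounds without
    any rounding operation. *)
Definition rounds :=
  While (Less (RMul (OfNat (load Round)) beta) (num 8)) one_round.

Definition tester :=
  If (Less AvgDegree (num 1)) skip (Seq (assign Verdict (Const 1)) rounds).

(** * Program logic for total correctness with step counts *)

Section Exec.
Variables (R : realType) (p : params R) (n : nat) (G : erased_lists n).
Implicit Types (c : cmd) (s : state n) (b : test) (Q : nat -> state n -> Prop).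

(** Quantifying over the remaining stack [k] makes executions compose under [Seq] and [While]. *)
Definition exec c s t s' := forall k, iter t (step p G) (c :: k, s) = (k, s').

Definition wp c Q s := exists t s', exec c s t s' /\ Q t s'.

Lemma wp_mono c Q1 Q2 s :
  (forall t s', Q1 t s' -> Q2 t s') -> wp c Q1 s -> wp c Q2 s.
Proof. by move=> Q12 [t [s' [ex /Q12]]]; exists t, s'. Qed.

Lemma wp_store a i e Q M w q (s := State M w q) :
  Q 1 (State (upd M a (neval s i) (neval s e)) w q) -> wp (Store a i e) Q s.
Proof. by eexists; eexists; split; last exact: H. Qed.

Lemma wp_sample a i Q M v w q (s := State M (v :: w) q) :
  Q 1 (State (upd M a (neval s i) (val v)) w q) -> wp (Sample a i) Q s.
Proof. by eexists; eexists; split; last exact: H. Qed.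

Lemma wp_deg a i e Q M w q (s := State M w q) :
  Q 1 (State (upd M a (neval s i) (deg_answer G (neval s e))) w q.+1) ->
  wp (DegQuery a i e) Q s.
Proof. by eexists; eexists; split; last exact: H. Qed.

Lemma wp_nbr a i e j Q M w q (s := State M w q) :
  Q 1 (State (upd M a (neval s i)
     (nbr_answer G (neval s e) (neval s j))) w q.+1) ->
  wp (NbrQuery a i e j) Q s.
Proof. by eexists; eexists; split; last exact: H. Qed.

Lemma wp_seq c1 c2 Q s :
  wp c1 (fun t1 => wp c2 (fun t2 => Q (t1 + t2).+1)) s -> wp (Seq c1 c2) Q s.
Proof.
move=> [t1 [s1 [ex1 [t2 [s2 [ex2 Qs]]]]]]; exists (t1 + t2).+1, s2.
split=> // k; rewrite iterSr addnC iterD.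
by case: s ex1 => M w q ex1; rewrite /= ex1 ex2.
Qed.

Lemma wp_if b c1 c2 Q s :
  wp (if teval p s b then c1 else c2) (fun t => Q t.+1) s ->
  wp (If b c1 c2) Q s.
Proof.
move=> [t [s1 [ex1 Qs]]]; exists t.+1, s1.
by split=> // k; rewrite iterSr -ex1; case: s ex1.
Qed.

(** [V] is a potential that pays for the steps. *)
Lemma wp_while (I : state n -> Prop) (V : state n -> nat) b c :
  (forall s, I s -> teval p s b ->
     wp c (fun t s' => I s' /\ t + V s' < V s) s) ->
  forall s, I s ->
    wp (While b c) (fun t s' => [/\ I s', ~~ teval p s' b & t <= (V s).+1]) s.
Proof.
move=> body s; have [m] := ubnP (V s); elim: m s => // m IHm s ltVm Is.
case def_b: (teval p s b); last first.
  exists 1, s; split; last by rewrite def_b.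
  by move=> k /=; case: s def_b {ltVm Is} => M w q /= ->.
have [t1 [s1 [ex1 [I1 V1]]]] := body s Is def_b.
have [|t2 [s2 [ex2 [I2 b2 V2]]]] := IHm s1 _ I1.
  exact: leq_ltn_trans (leq_addl _ _) (leq_trans V1 ltVm).
exists (t1 + t2).+1, s2; split; last first.
  split=> //; rewrite ltnS (leq_trans _ V1) // -addnS leq_add2l //.
move=> k; rewrite iterSr addnC iterD.
by case: s def_b ex1 {ltVm Is V1} => M w q /= -> ex1; rewrite ex1 ex2.
Qed.

(** Each step makes at most one query, so every time bound is also a query bound. *)
Lemma queries_iter_step t (x : config n) :
  queries (iter t (step p G) x).2 <= queries x.2 + t.
Proof.
elim: t => [|t IHt]; first by rewrite addn0.
rewrite iterS addnS; case: (iter t _ x) IHt => [[|c k] [M w q]] /=.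
  exact: leqW.
case: c => /= [a i e|a i|a i e|a i e j|c1 c2|b c1 c2|b c] IHt; try exact: leqW IHt.
- by case: w IHt => [|v w] /leqW.
- by rewrite ltnS.
- by rewrite ltnS.
Qed.

(** A configuration with empty stack is a fixed point of [step], so surplus steps change nothing. *)
Lemma exec_run c t t' w s' :
  exec c (State (fun _ _ => 0) w 0) t' s' -> t' <= t ->
  run p G c t w = ([::], s').
Proof.
move=> ex /subnK<-; rewrite /run iterD ex.
by elim: (t - t') => // k IHk; rewrite iterS IHk; case: s' {ex IHk}.
Qed.

End Exec.

(** * Correctness and cost of the search *)

Section Search.
Variables (R : realType) (p : params R) (n : nat) (G : erased_lists n).
Implicit Types (s : state n) (M : nat -> nat -> nat) (q : seq 'I_n).

Definition arc : rel 'I_n := fun x y => Some y \in G x.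

Definition small_degree (D : nat) : bool :=
  let gap := (p_eps p - p_alpha p)%R in
  ~~ (64%:R < D%:R * (gap * p_deg p) * (gap * p_deg p))%R
  && ~~ (8%:R < D%:R * gap)%R.

(** The starting vertices that make a round reject, described by reachability along nonerased
    entries and thus independently of the order of the search. *)
Definition convicting v :=
  let S := [set x | connect arc v x] in
  [&& small_degree (\sum_(x in S) size (G x)),
      \sum_(x in S) count_mem None (G x) < 2,
      ~~ odd (\sum_(x in S) size (G x)) & #|S| < n].

(** Used with [foldr], which handles the last entry first, in the order in which [scan_entry] reads
    a list. *)
Definition add_entry (o : option 'I_n) q :=
  if o is Some y then if y \in q then q else rcons q y else q.

Lemma mem_add_entries q l y :
  (y \in foldr add_entry q l) = (y \in q) || (Some y \in l).
Proof.
elim: l => [|o l IHl] /=; first by rewrite orbF.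
rewrite inE; case: o => [x|] /=; last by rewrite IHl.
rewrite -[Some y == _]/(y == x) orbCA -IHl.
case: ifP => x_in; last by rewrite mem_rcons inE.
by case: eqP => // ->.
Qed.

Lemma uniq_add_entries q l : uniq q -> uniq (foldr add_entry q l).
Proof.
move=> Uq; elim: l => //= -[x|] l IHl //=.
by case: ifP => // /negbT x_notin; rewrite rcons_uniq x_notin.
Qed.

Lemma size_add_entries q l : size (foldr add_entry q l) <= size q + size l.
Proof.
elim: l => [|o l IHl] /=; first by rewrite addn0.
rewrite addnS; case: o => [x|] /=; last exact: leqW.
by case: ifP => _; rewrite ?size_rcons; rewrite ?ltnS ?leqW.
Qed.

(** The queue only grows at its end, so the vertex at position [Front] does not change while its
    list is scanned. *)
Lemma add_entries_cat q l : exists q', foldr add_entry q l = q ++ q'.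
Proof.
elim: l => [|o l [q' def_q']] /=; first by exists [::]; rewrite cats0.
case: o => [x|] /=; last by exists q'.
case: ifP => _; first by exists q'.
by exists (rcons q' x); rewrite def_q' rcons_cat.
Qed.

Lemma teval_nless s e1 e2 : teval p s (nless e1 e2) = (neval s e1 < neval s e2).
Proof. by rewrite /= ltr_nat. Qed.

Record repr (v0 : 'I_n) (r res D e : nat) (b : bool) (h : nat) q M := Repr {
  repr_round : M Round 0 = r;
  repr_verdict : M Verdict 0 = res;
  repr_total : M Total 0 = D;
  repr_erased : M Erased 0 = e;
  repr_parity : M Parity 0 = b;
  repr_front : M Front 0 = h;
  repr_found : M Reached 0 = size q;
  repr_queue : forall i, i < size q -> M Queue i = nth v0 q i;
  repr_seen : forall x : 'I_n, M Seen x <= r /\ ((M Seen x == r) = (x \in q)) }.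

Lemma scan_entry_spec v0 r res D e (b : bool) h q j w M qn :
  let l := G (nth v0 q h) in
  repr v0 r res D e b h q M -> h < size q -> M Todo 0 = j.+1 ->
  wp p G scan_entry (fun t s' =>
    [/\ t <= 20, tape s' = w, Defs.mem s' Todo 0 = j &
        repr v0 r res D (e + (nth None l j == None)) (~~ b) h
          (add_entry (nth None l j) q) (Defs.mem s')]) (State M w qn).
Proof.
move=> l rM lt_h def_j; have [def_r def_v def_D def_e def_b def_h def_q Hq Hs] := rM.
have nbr : nbr_answer G (M Queue h) j = if nth None l j is Some u then u.+1 else 0.
  by rewrite Hq // /nbr_answer valK.
apply: wp_seq; apply: wp_store; rewrite /= /upd /= def_j subn1 /=.
apply: wp_seq; apply: wp_nbr; rewrite /= /upd /= def_h /= nbr.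
apply: wp_seq; apply: wp_store; rewrite /= /upd /= def_b.
apply: wp_if; rewrite teval_nless /=.
case def_o: (nth None l j) => [u|] /=; last first.
  apply: wp_store; rewrite /= /upd /=; split=> //.
  by split; rewrite //= ?def_e ?addn1 //; case: (b).
rewrite addn0; apply: wp_if; rewrite teval_nless /= subn1 /= def_r.
have [le_u def_u] := Hs u; rewrite ltn_neqAle def_u le_u andbT.
case: ifP => u_q /=.
  apply: wp_seq; apply: wp_store; rewrite /= /upd /= subn1 def_r /=.
  apply: wp_seq; apply: wp_store; rewrite /= /upd /= def_q /= subn1.
  apply: wp_store; rewrite /= /upd /= def_q.
  rewrite (negPf u_q); split=> //; split; rewrite //= ?size_rcons ?addn1 //.
  - by case: (b).
  - move=> i; rewrite ltnS nth_rcons leq_eqVlt.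
    by case: eqP => [->|_ /= lt_i]; rewrite ?ltnn ?lt_i ?eqxx //= Hq.
  move=> x; rewrite mem_rcons inE -(inj_eq val_inj).
  by case: eqP => _; rewrite ?leqnn ?eqxx //; apply: Hs.
move/negbFE: u_q => u_q; rewrite u_q.
apply: wp_store; rewrite /= /upd /=; split=> //.
by split; rewrite //=; case: (b).
Qed.

Lemma scan_list_spec v0 r res D e (b : bool) h q w M qn :
  let l := G (nth v0 q h) in
  repr v0 r res D e b h q M -> h < size q -> M Todo 0 = size l ->
  wp p G scan_list (fun t s' =>
    [/\ t <= 21 * size l + 1, tape s' = w &
        repr v0 r res D (e + count_mem None l) (b (+) odd (size l)) h
          (foldr add_entry q l) (Defs.mem s')]) (State M w qn).
Proof.
move=> l rM lt_h def_todo.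
pose inv s := exists j, [/\ j <= size l, Defs.mem s Todo 0 = j, tape s = w &
  repr v0 r res D (e + count_mem None (drop j l)) (b (+) odd (size (drop j l))) h
     (foldr add_entry q (drop j l)) (Defs.mem s)].
(* Per entry: at most 20 steps for the body and one for the loop test. *)
pose V s := 21 * Defs.mem s Todo 0.
have body s : inv s -> teval p s (nless (Const 0) (load Todo)) ->
    wp p G scan_entry (fun t s' => inv s' /\ t + V s' < V s) s.
  case: s => M1 w1 q1 [[|j] [lt_j /= def_j -> rM1]].
    by rewrite def_j ltxx.
  move=> _; have [q' def_q'] := add_entries_cat q (drop j.+1 l).
  have nth_h: nth v0 (foldr add_entry q (drop j.+1 l)) h = nth v0 q h.
    by rewrite def_q' nth_cat lt_h.
  have lt_h1: h < size (foldr add_entry q (drop j.+1 l)).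
    by rewrite def_q' size_cat ltn_addr.
  apply: wp_mono (scan_entry_spec w q1 rM1 lt_h1 def_j) => t s'.
  rewrite nth_h -/l => -[le_t def_w def_j' rM']; split.
    exists j; split=> //; first exact: ltnW.
    by rewrite (drop_nth None lt_j) /= addbN addnCA [_ + (e + _)]addnC.
  by rewrite /V def_j' /= def_j mulnS addnC -addnS addnC leq_add2r.
have inv0 : inv (State M w qn).
  by exists (size l); rewrite drop_size /= addn0 addbF.
apply: wp_mono (wp_while body inv0) => t s' [[j [_ def_j tape_s' rM']] /= hj le_t].
move: hj rM'; rewrite ltr_nat def_j -eqn0Ngt => /eqP->; rewrite drop0.
by split=> //; rewrite addn1 (leq_trans le_t) // /V /= def_todo.
Qed.

(** Loop invariant of [explore]. The last clause is conditional because the list that makes the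
    total degree too large is not read. The bound on [size q] holds since every reached vertex other
    than [v0] comes from an entry that was read. *)
Definition scanned v0 res r h q M := exists e b,
  let q1 := take h q in
  let D := \sum_(x <- q1) size (G x) in
  [/\ repr v0 r res D e b h q M,
      h <= size q, uniq q, v0 \in q /\ {subset q <= connect arc v0} &
      small_degree D ->
      [/\ e = \sum_(x <- q1) count_mem None (G x), b = odd D,
          size q <= D.+1 &
          forall x y, x \in q1 -> arc x y -> y \in q]].

Variable L : nat.
Hypothesis small_degree_le : forall D, small_degree D -> D <= L.

Lemma teval_within s : teval p s within = small_degree (Defs.mem s Total 0).
Proof. by []. Qed.

(** Amortized cost: 40 for each vertex waiting in the queue pays the constant overhead; 80 for each
    unit of degree still allowed pays 21 steps for reading an entry and 40 for the vertex that it
    may append. *)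
Lemma scan_vertex_spec v0 res r h q w M qn :
  h < size q -> scanned v0 res r h q M ->
  small_degree (\sum_(x <- take h q) size (G x)) ->
  wp p G scan_vertex (fun t s' => tape s' = w /\ exists q',
    [/\ scanned v0 res r h.+1 q' (Defs.mem s') &
    t + 40 * (size q' - h.+1) + 80 * (L - \sum_(x <- take h.+1 q') size (G x))
     < 40 * (size q - h) + 80 * (L - \sum_(x <- take h q) size (G x))])
    (State M w qn).
Proof.
move=> lt_h [e [b [rM _ Uq [v0q reach_q] small_q]]] small_D.
have [def_e def_b le_q closed_q] := small_q small_D.
have [def_r def_v def_D _ _ def_h def_q Hq Hs] := rM.
set D := \sum_(x <- _) _ in rM small_q small_D def_b le_q def_D *.
set u := nth v0 q h; set l := G u.
have take_h: take h.+1 q = rcons (take h q) u by rewrite (take_nth v0 lt_h).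
apply: wp_seq; apply: wp_deg; rewrite /= /upd /= def_h /= Hq // /deg_answer valK -/u -/l.
apply: wp_seq; apply: wp_store; rewrite /= /upd /= def_D.
have rM1: repr v0 r res (D + size l) e b h q
   (fun a i => if (a == Total) && (i == 0) then D + size l else
     if (a == Todo) && (i == 0) then size l else M a i).
  by case: rM => *; split.
apply: wp_seq; apply: wp_if; rewrite teval_within /=.
case: ifP => small_D1; last first.
  apply: wp_store; rewrite /= /upd /=; apply: wp_store; rewrite /= /upd /= def_h.
  split=> //; exists q; split.
    (* The new total is too large, so the conditional clause is vacuous and the old counters
       serve. *)
    exists e, b; rewrite /= take_h -cats1 big_cat big_seq1 -/D; split=> //.
    - by case: rM => *; split; rewrite //= addn1.
    - by rewrite small_D1.
  rewrite take_h -cats1 big_cat big_seq1 -/D -/l /=.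
  lia.
have rW := scan_list_spec w qn.+1 rM1 lt_h erefl.
apply: wp_mono rW => t [M2 w2 q2] /= [le_t -> rM2].
have [_ _ _ _ _ def_h2 _ _ _] := rM2.
apply: wp_store; rewrite /= /upd /= def_h2.
split=> //.
have [qx def_qx] := add_entries_cat q l.
exists (foldr add_entry q l).
have take_h1: take h.+1 (foldr add_entry q l) = rcons (take h q) u.
  by rewrite def_qx takel_cat.
have size_q' := size_add_entries q l.
have le_qq': size q <= size (foldr add_entry q l).
  by rewrite def_qx size_cat leq_addr.
have sum1 : \sum_(x <- rcons (take h q) u) size (G x) = D + size l.
  by rewrite -cats1 big_cat big_seq1.
split; last first.
  have le_D1 := small_degree_le small_D1.
  rewrite take_h1 sum1; move: le_t; rewrite -/u -/l; lia.
exists (e + count_mem None l), (b (+) odd (size l)).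
rewrite /= take_h1 sum1; split.
- by case: rM2 => *; split=> //=; rewrite addn1.
- exact: leq_trans le_qq'.
- exact: uniq_add_entries.
- split; first by rewrite mem_add_entries v0q.
  move=> x; rewrite mem_add_entries => /orP[/reach_q//|lx].
  by apply: connect_trans (connect1 lx); apply: reach_q; rewrite mem_nth.
move=> _; split.
- by rewrite -cats1 big_cat big_seq1 def_e.
- by rewrite oddD def_b.
- by rewrite (leq_trans size_q') // -addSn leq_add2r.
move=> x y; rewrite mem_rcons inE mem_add_entries => /orP[/eqP->|xq] xy.
  by rewrite [_ \in l]xy orbT.
by rewrite (closed_q x).
Qed.

Lemma explore_spec v0 res r q w M qn :
  scanned v0 res r 0 q M ->
  wp p G explore (fun t s' =>
    [/\ t <= 40 * size q + 80 * L + 1, tape s' = w & exists h q',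
       scanned v0 res r h q' (Defs.mem s') /\
       (h < size q' -> ~~ small_degree (\sum_(x <- take h q') size (G x)))])
    (State M w qn).
Proof.
move=> scM.
pose inv s := tape s = w /\ exists h q, scanned v0 res r h q (Defs.mem s).
pose V s := 40 * (Defs.mem s Reached 0 - Defs.mem s Front 0)
            + 80 * (L - Defs.mem s Total 0).
have body s :
    inv s -> teval p s (And (nless (load Front) (load Reached)) within) ->
    wp p G scan_vertex (fun t s' => inv s' /\ t + V s' < V s) s.
  case: s => M1 w1 q1 [/= -> [h [q2 scM1]]].
  have [e [b [[_ _ def_D _ _ def_h def_q _ _] _ _ _ _]]] := scM1.
  rewrite ltr_nat -/(small_degree (M1 Total 0)) def_h def_q def_D.
  case/andP=> lt_h small_D.
  apply: wp_mono (scan_vertex_spec w q1 lt_h scM1 small_D) => t s'.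
  move=> [def_w [q' [scM' lt_t]]]; split; first by split=> //; exists h.+1, q'.
  rewrite /V /= def_h def_q def_D.
  case: scM' => e' [b' [[_ _ -> _ _ -> -> _ _] _ _ _ _]].
  by rewrite addnA.
have inv0 : inv (State M w qn) by split=> //; exists 0, q.
apply: wp_mono (wp_while body inv0) => t s' [[def_w [h [q' scM']]] halt le_t].
split=> //.
  rewrite (leq_trans le_t) // addn1 ltnS /V /=.
  case: scM => e' [b' [[_ _ -> _ _ -> -> _ _] _ _ _ _]].
  by rewrite subn0 leq_add2l leq_mul2l leq_subr.
exists h, q'; split=> // lt_h; move: halt => /=.
case: scM' => e' [b' [[_ _ def_D _ _ def_h def_q _ _] _ _ _ _]].
by rewrite ltr_nat -/(small_degree (Defs.mem s' Total 0)) def_h def_q def_D lt_h.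
Qed.

Hypotheses (gap_ge0 : (0 <= p_eps p - p_alpha p)%R) (deg_ge0 : (0 <= p_deg p)%R).

Lemma small_degree_leq D1 D2 : D1 <= D2 -> small_degree D2 -> small_degree D1.
Proof.
move=> leD; rewrite /small_degree -!leNgt => /andP[le64 le8].
by apply/andP; split; [apply: le_trans le64 | apply: le_trans le8];
   rewrite ?ler_wpM2r ?mulr_ge0 ?ler_nat.
Qed.

(** If the search stopped because of the bound, the total degree of the whole reachable set exceeds
    it too, by monotonicity, and both sides are false. Otherwise the queue was scanned completely
    and is exactly the reachable set. *)
Lemma teval_found v0 res r h q s :
  scanned v0 res r h q (Defs.mem s) ->
  (h < size q -> ~~ small_degree (\sum_(x <- take h q) size (G x))) ->
  teval p s found = convicting v0.
Proof.
move=> [e [b [rM le_h Uq [v0q reach_q] small_q]]] not_small.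
have [_ _ def_D def_e def_b _ def_q _ _] := rM.
have -> : teval p s found = [&& small_degree (Defs.mem s Total 0),
    Defs.mem s Erased 0 < 2, Defs.mem s Parity 0 < 1 & Defs.mem s Reached 0 < n].
  by rewrite /= -!/(small_degree _) !ltr_nat.
rewrite /convicting; set S := [set x | _].
have sumE (F : 'I_n -> nat) (q1 : seq 'I_n) :
    uniq q1 -> \sum_(x <- q1) F x = \sum_(x in q1) F x.
  by move=> Uq1; rewrite big_uniq.
have le_sum : \sum_(x <- take h q) size (G x) <= \sum_(x in S) size (G x).
  rewrite sumE ?take_uniq // [leqRHS](bigID (mem (take h q))) /=.
  rewrite (eq_bigl (fun x => (x \in S) && (x \in take h q))) ?leq_addr // => x.
  by rewrite inE andb_idl // => /mem_take/reach_q.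
rewrite def_D def_e def_b def_q.
case small_D: (small_degree _) not_small small_q => not_small small_q; last first.
  by symmetry; apply/negP=> /andP[/(small_degree_leq le_sum)]; rewrite small_D.
have {not_small}def_h : h = size q.
  by apply/eqP; rewrite eqn_leq le_h leqNgt; apply/negP=> /not_small.
rewrite {}def_h take_size in small_D small_q le_sum *.
have [-> -> _ closed_q] := small_q isT.
(* The scanned queue contains [v0] and is closed under nonerased entries, hence contains every path
   from [v0]. *)
have defS : S =i q.
  move=> x; rewrite inE; apply/idP/idP=> [/connectP[c]|]; last exact: reach_q.
  elim: c v0 v0q {rM reach_q S small_q le_sum} => [|y c IHc] v0 v0q /=.
    by move=> _ ->.
  by case/andP=> /(closed_q _ _ v0q) yq pc; apply: IHc.
have sumS (F : 'I_n -> nat) : \sum_(x <- q) F x = \sum_(x in S) F x.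
  by rewrite sumE //; apply: eq_bigl => x; rewrite defS.
rewrite !sumS in small_D *; rewrite small_D.
by rewrite -(card_uniqP Uq) -(eq_card defS); case: odd.
Qed.

Lemma one_round_spec v w r M qn :
  M Round 0 = r -> (forall x : 'I_n, M Seen x <= r) ->
  wp p G one_round (fun t s' =>
    [/\ t <= 80 * L + 80, tape s' = w, Defs.mem s' Round 0 = r.+1,
        Defs.mem s' Verdict 0 = if convicting v then 0 else M Verdict 0 &
        forall x : 'I_n, Defs.mem s' Seen x <= r.+1]) (State M (v :: w) qn).
Proof.
move=> def_r le_seen.
apply: wp_seq; apply: wp_store; rewrite /= /upd /= def_r addn1.
apply: wp_seq; apply: wp_sample; rewrite /= /upd /=.
do 5!(apply: wp_seq; apply: wp_store; rewrite /= /upd /=).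
apply: wp_seq; apply: wp_store; rewrite /= /upd /=.
set M1 := (X in State X w).
have scM : scanned v (M Verdict 0) r.+1 0 [:: v] M1.
  exists 0, false; rewrite /= big_nil; split=> //; last first.
  - by move=> _; split=> //; rewrite big_nil.
  - by split=> [|x]; rewrite inE // => /eqP->; apply: connect0.
  split=> //= [[]|x] //; rewrite inE /M1 /= -(inj_eq val_inj) /=.
  case: eqP => _; rewrite ?leqnn ?eqxx //.
  by split; [apply: leqW | rewrite ltn_eqF // ltnS].
apply: wp_seq; apply: wp_mono (explore_spec w qn scM) => t s'.
move=> [/= le_t def_w [h [q [scM' stop]]]].
apply: wp_if; rewrite (teval_found scM' stop).
case: scM' => e' [b' [[def_r' def_v _ _ _ _ _ _ Hs] _ _ _ _]].
case: s' def_w def_r' def_v Hs {stop} => M2 w2 q2 /= -> def_r' def_v Hs.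
case: ifP => _; apply: wp_store; rewrite /= /upd /=; split=> //.
- lia.
- by move=> x; case: (Hs x).
- lia.
by move=> x; case: (Hs x).
Qed.

Variable T : nat.
Hypothesis enough_rounds : forall r,
  (r%:R * ((p_eps p - p_alpha p) * p_deg p) < 8%:R)%R = (r < T).

Lemma rounds_spec w M qn :
  M Round 0 = 0 -> M Verdict 0 = 1 -> (forall x : 'I_n, M Seen x = 0) ->
  T <= size w ->
  wp p G rounds (fun t s' => t <= T * (80 * L + 81) + 1 /\
    Defs.mem s' Verdict 0 = ~~ has convicting (take T w)) (State M w qn).
Proof.
move=> def_r def_v Hs le_T.
pose inv s := let r := Defs.mem s Round 0 in
  [/\ r <= T, tape s = drop r w,
     Defs.mem s Verdict 0 = ~~ has convicting (take r w) &
     forall x : 'I_n, Defs.mem s Seen x <= r].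
pose V s := (T - Defs.mem s Round 0) * (80 * L + 81).
have body s :
    inv s -> teval p s (Less (RMul (OfNat (load Round)) beta) (num 8)) ->
    wp p G one_round (fun t s' => inv s' /\ t + V s' < V s) s.
  case: s => M1 w1 q1 [/= _ -> def_v1 Hs1]; rewrite enough_rounds /= => lt_r.
  have lt_w : M1 Round 0 < size w by apply: leq_trans le_T.
  case def_w: (drop (M1 Round 0) w) => [|v w2].
    by rewrite -subn_gt0 -size_drop def_w in lt_w.
  apply: wp_mono (one_round_spec v w2 q1 erefl Hs1) => t [M2 w3 q2] /=.
  move=> [le_t -> def_r2 def_v2 Hs2]; split.
    move: def_w; rewrite (drop_nth v lt_w) => -[def_v0 def_w2].
    split; rewrite /= def_r2 //.
    rewrite (take_nth v lt_w) has_rcons def_v0 def_v2 def_v1.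
    by case: (convicting v).
  by rewrite /V /= def_r2 -(subnSK lt_r) mulSn -addSn leq_add2r; lia.
have inv0 : inv (State M w qn).
  by split; rewrite /= def_r ?drop0 ?take0 // => x; rewrite Hs.
apply: wp_mono (wp_while body inv0) => t s' [[le_r _ def_v' _] /= stop le_t].
split; first by rewrite addn1 (leq_trans le_t) // /V /= def_r subn0.
move: stop; rewrite enough_rounds -leqNgt => ge_r.
by rewrite def_v'; have -> : Defs.mem s' Round 0 = T by apply/eqP; rewrite eqn_leq le_r.
Qed.

Lemma run_tester t (w : seq 'I_n) :
  (1%:R <= p_deg p)%R -> T <= size w -> T * (80 * L + 81) + 5 <= t ->
  halted (run p G tester t w) /\
  accepting (run p G tester t w) = ~~ has convicting (take T w).
Proof.
move=> deg_ge1 le_T le_t.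
have: wp p G tester (fun t' s' => t' <= t /\
    Defs.mem s' Verdict 0 = ~~ has convicting (take T w))
    (State (fun _ _ => 0) w 0).
  apply: wp_if; rewrite /= ltNge deg_ge1 /=.
  apply: wp_seq; apply: wp_store; rewrite /= /upd /=.
  set M := (X in State X w).
  apply: wp_mono (@rounds_spec w M 0 erefl erefl (fun=> erefl) le_T).
  by move=> t' s' [le_t' ->]; split=> //; lia.
case=> t' [s' [ex [le_t' def_v]]]; rewrite (exec_run ex le_t').
by split=> //; rewrite /accepting /= def_v; case: (~~ _).
Qed.

Lemma run_tester_sparse t w : (p_deg p < 1%:R)%R -> 1 < t ->
  run p G tester t w = ([::], State (upd (fun _ _ => 0) Todo 0 0) w 0).
Proof.
move=> deg_lt1 lt1t; apply: exec_run lt1t => k.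
by rewrite /= deg_lt1.
Qed.

End Search.

(** * Components of a completion *)

Definition adj n (A : adj_lists n) : rel 'I_n := fun x y => y \in A x.

Section Completions.
Variables (n : nat) (G : erased_lists n) (A : adj_lists n).
Hypothesis compA : completion G A.
Implicit Types (x y u v : 'I_n) (S : {set 'I_n}).

Local Notation e := (adj A).

Lemma adj_uniq x : uniq (A x). Proof. by case: compA => -[]. Qed.
Lemma adj_irr x : x \notin A x. Proof. by case: compA => -[]. Qed.
Lemma adj_sym x y : (x \in A y) = (y \in A x). Proof. by case: compA => -[]. Qed.

Lemma size_completion x : size (G x) = size (A x).
Proof. by case: compA => _ /(_ x); rewrite all2E => /andP[/eqP]. Qed.

Lemma sub_arc_adj x y : arc G x y -> e x y.
Proof.
rewrite /arc /adj; case: compA => _ /(_ x).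
elim: (G x) (A x) => [|o l IHl] [|z s] //= /andP[oz /IHl{}IHl].
rewrite !inE => /orP[/eqP def_o|/IHl->]; last by rewrite orbT.
by move: oz; rewrite -def_o /= => /eqP[->]; rewrite eqxx.
Qed.

(** A neighbor in [A] that violates [P] cannot stand at a nonerased position of [G x]. *)
Lemma count_erased x (P : pred 'I_n) :
  (forall y, arc G x y -> P y) -> count (predC P) (A x) <= count_mem None (G x).
Proof.
rewrite /arc; case: compA => _ /(_ x).
elim: (G x) (A x) => [|o l IHl] [|z s] //= /andP[oz /IHl{}IHl] arcP.
rewrite leq_add // ?IHl // => [|y ly]; last by rewrite arcP ?inE ?ly ?orbT.
case: o oz arcP => [y|] /=; last by case: (P z).
by move=> /eqP[->] ->; rewrite ?inE ?eqxx.
Qed.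

Lemma count_adj P x : count P (A x) = \sum_y (e x y && P y).
Proof.
rewrite -size_filter -(card_uniqP (filter_uniq P (adj_uniq x))).
by rewrite -sum1_card big_mkcond; apply: eq_bigr => y _; rewrite mem_filter andbC; case: (_ && _).
Qed.

Lemma sum_sym_half (F : 'I_n -> 'I_n -> nat) :
  (forall x y, F x y = F y x) -> (forall x, F x x = 0) ->
  \sum_x \sum_y F x y = (\sum_(x : 'I_n) \sum_(y : 'I_n | x < y) F x y).*2.
Proof.
move=> Fsym F0; rewrite -addnn -[X in _ + X]/(\sum_x _) [X in _ + X](exchange_big_dep predT) //=.
rewrite -big_split; apply: eq_bigr => x _ /=.
rewrite (bigID (fun y : 'I_n => x < y)) /=; congr (_ + _).
rewrite (bigID (pred1 x)) /= (eq_bigl (pred1 x)); last first.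
  by move=> y; rewrite -leqNgt andb_idl // => /eqP->.
rewrite big_pred1_eq F0 add0n.
apply: eq_big => [y|y _]; last by rewrite Fsym.
by rewrite -leqNgt ltn_neqAle -(inj_eq val_inj) andbC eq_sym.
Qed.

Lemma handshake S : ~~ odd (\sum_(x in S) count (mem S) (A x)).
Proof.
pose F x y : nat := [&& x \in S, y \in S & e x y].
have -> : \sum_(x in S) count (mem S) (A x) = \sum_x \sum_y F x y.
  rewrite big_mkcond; apply: eq_bigr => x _; rewrite /F; case: ifP => xS.
    by rewrite count_adj; apply: eq_bigr => y _; rewrite andbC.
  by rewrite big1.
rewrite sum_sym_half ?odd_double // => [x y|x]; rewrite /F /adj.
  by rewrite adj_sym andbCA.
by rewrite (negPf (adj_irr x)) !andbF.
Qed.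

(** The degree sum counts each adjacent pair [x < y] twice, and these pairs map onto the edges. *)
Lemma card_edges_le : #|edges A|.*2 <= \sum_x size (G x).
Proof.
have -> : \sum_x size (G x) = \sum_x \sum_y e x y.
  apply: eq_bigr => x _; rewrite size_completion -count_predT count_adj.
  by apply: eq_bigr => y _; rewrite andbT.
rewrite sum_sym_half ?leq_double => [|x y|x]; rewrite /adj; last 2 first.
- by rewrite adj_sym.
- by rewrite (negPf (adj_irr x)).
pose up := [set p : 'I_n * 'I_n | (p.1 < p.2) && e p.1 p.2].
have -> : \sum_(x : 'I_n) \sum_(y : 'I_n | x < y) e x y = #|up|.
  rewrite -sum1_card pair_big_dep /= [RHS]big_mkcond [LHS]big_mkcond /=.
  by apply: eq_bigr => p _; rewrite inE; case: ifP => //= _; case: (e _ _).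
apply: leq_trans (leq_imset_card (fun p => [set p.1; p.2]) up).
apply: subset_leq_card; apply/subsetP=> _ /imset2P[x y _ xy ->].
have{}xy : e x y by [].
case: (ltngtP x y) => [lt_xy|lt_yx|/val_inj eq_xy].
- by apply/imsetP; exists (x, y); rewrite ?inE ?lt_xy.
- by apply/imsetP; exists (y, x); rewrite ?inE ?lt_yx /= 1?setUC // /adj adj_sym.
by move: xy; rewrite /adj eq_xy (negPf (adj_irr y)).
Qed.

Lemma closed_connected S x :
  connected_graph A -> x \in S -> (forall y z, y \in S -> e y z -> z \in S) ->
  S = setT.
Proof.
move=> conA xS clS; apply/setP=> y; rewrite inE.
have /connectP[c] := conA x y.
by elim: c x xS => [|z c IHc] x xS /= => [_ ->|/andP[/(clS _ _ xS)/IHc]].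
Qed.

Section Convicting.
Variables (R : realType) (p : params R).

(** The number of edges leaving the set reached from [v] is at most the number
  of erased entries in the set and has the parity of its total degree. *)
Lemma convicting_disconnected v : connected_graph A -> ~~ convicting p G v.
Proof.
move=> conA; apply/and4P=> -[_]; set S := [set x | _] => eS evS ltSn.
have vS : v \in S by rewrite inE connect0.
have clS x y : x \in S -> arc G x y -> y \in S.
  by rewrite !inE => vx xy; apply: connect_trans vx (connect1 xy).
have sumS : \sum_(x in S) size (G x) = \sum_(x in S) count (mem S) (A x)
    + \sum_(x in S) count (predC (mem S)) (A x).
  by rewrite -big_split; apply: eq_bigr => x _; rewrite /= count_predC size_completion.
have le1 : \sum_(x in S) count (predC (mem S)) (A x) <= 1.
  rewrite -ltnS (leq_ltn_trans _ eS) //; apply: leq_sum => x xS.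
  by apply: count_erased => y; apply: clS.
move: evS; rewrite sumS oddD (negPf (handshake S)) /= => ev0.
have /eqP : \sum_(x in S) count (predC (mem S)) (A x) = 0.
  by case: (\sum_(x in S) _) le1 ev0 => [|[]].
rewrite sum_nat_eq0 => /forall_inP out0.
have defS : S = setT.
  apply: (closed_connected conA vS) => x y xS xy; apply/negP=> /negP yS.
  have := out0 x xS; rewrite -leqn0 leqNgt -has_count => /hasP[].
  by exists y.
by move: ltSn; rewrite defS cardsT card_ord ltnn.
Qed.

End Convicting.
End Completions.

(** * Connected components of a completion, represented by their roots *)

Section Components.
Variables (n : nat) (G : erased_lists n) (A : adj_lists n).
Hypothesis compA : completion G A.
Implicit Types (x y u v : 'I_n).
Local Notation e := (adj A).
Local Notation root := fingraph.root.

Definition component x := [set y | connect e x y].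
Definition roots_of := [set x | root e x == x].

Lemma adj_connect_sym : connect_sym e.
Proof. by apply: sym_connect_sym => x y; rewrite /adj (adj_sym compA). Qed.

Lemma componentP x y : (y \in component x) = (root e y == root e x).
Proof. by rewrite inE eq_sym (root_connect adj_connect_sym). Qed.

Lemma component_closed x0 x y : x \in component x0 -> e x y -> y \in component x0.
Proof. by rewrite !inE => x0x xy; apply: connect_trans x0x (connect1 xy). Qed.

Lemma sum_components (F : 'I_n -> nat) :
  \sum_(x in roots_of) \sum_(y in component x) F y = \sum_y F y.
Proof.
rewrite [RHS](partition_big (root e) (mem roots_of)) /= => [|y _]; last first.
  by rewrite inE (root_root adj_connect_sym).
apply: eq_bigr => x; rewrite inE => /eqP rx; apply: eq_bigl => y.
by rewrite componentP rx.
Qed.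

Lemma component_sum_even x0 : ~~ odd (\sum_(x in component x0) size (G x)).
Proof.
have -> : \sum_(x in component x0) size (G x) =
    \sum_(x in component x0) count (mem (component x0)) (A x).
  apply: eq_bigr => x xK; rewrite (size_completion compA) -count_predT.
  by apply: eq_in_count => y xy; rewrite /= (component_closed xK).
exact: (handshake compA).
Qed.

(** All neighbors of a vertex lie in its component. This turns a bound [8 / beta] on the vertices
    into the bound [(8 / beta) ^ 2] on the total degree. *)
Lemma component_sum_le x0 :
  \sum_(x in component x0) size (G x) <= #|component x0| ^ 2.
Proof.
rewrite -mulnn -sum_nat_const; apply: leq_sum => x xK.
rewrite (size_completion compA) -(card_uniqP (adj_uniq compA x)).
by apply/subset_leq_card/subsetP => y; apply: component_closed.
Qed.

(** If the entry for [v] in the list of [u] is the only erased one, then a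
  simple path from [v] never uses it. *)
Lemma component_start x0 :
  \sum_(x in component x0) count_mem None (G x) <= 1 ->
  exists2 v, connect e x0 v & [set y | connect (arc G) v y] = component x0.
Proof.
set K := component x0 => le1.
(* Ordered pairs, because an edge may be erased in the list of one endpoint only. *)
pose hidden := [set z : 'I_n * 'I_n |
  [&& z.1 \in K, e z.1 z.2 & ~~ arc G z.1 z.2]].
have hidden1 : #|hidden| <= 1.
  apply: leq_trans le1.
  have -> : #|hidden| = \sum_x \sum_y (if (x, y) \in hidden then 1 else 0).
    by rewrite -sum1_card big_mkcond pair_bigA; apply: eq_bigr => -[].
  rewrite [leqRHS]big_mkcond; apply: leq_sum => x _; case: ifP => xK; last first.
    by rewrite big1 // => y _; rewrite inE /= xK.
  apply: leq_trans (count_erased compA (P := arc G x) _) => //.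
  rewrite (count_adj compA); apply: leq_sum => y _.
  by rewrite inE /= xK /=; case: (_ && _).
(* [v] is the head of the hidden pair, or [x0] if nothing is hidden. *)
have [v x0v hid] : exists2 v, connect e x0 v &
    forall x y, x \in K -> e x y -> y != v -> arc G x y.
  have [[u v] uv|hid] := pickP [in hidden].
    exists v; first by move: uv; rewrite !inE /= => /and3P[x0u uv _];
      apply: connect_trans x0u (connect1 uv).
    move=> x y xK xy; apply: contraR => nxy.
    have xy_hid : (x, y) \in hidden by rewrite inE /= xK xy.
    by have [_ ->] := card_le1_eqP hidden1 _ _ xy_hid uv.
  exists x0 => // x y xK xy _; apply/negPn/negP=> nxy.
  by have := hid (x, y); rewrite /= inE /= xK xy nxy.
exists v => //; apply/setP=> y; rewrite !inE; apply/idP/idP => [|x0y].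
  move=> vy; apply: connect_trans x0v _; apply: connect_sub vy => x z xz.
  exact/connect1/(sub_arc_adj compA).
have /connectP[c0] : connect e v y.
  by apply: connect_trans x0y; rewrite adj_connect_sym.
case/shortenP=> c /= ec /andP[v_c _] _ ->.
have vK : v \in K by rewrite inE.
apply/connectP; exists c => //; elim: c {-2}v vK v_c ec => //= z c IHc x xK.
rewrite inE negb_or eq_sym => /andP[zv v_c] /andP[xz ec].
by rewrite hid //=; apply: IHc; rewrite ?(component_closed xK).
Qed.

(** Joining [z] to all other roots adds a star that links the components, with one new edge per
    other root. So a graph far from connected has many roots. *)
Lemma edge_dist_star z (rz : z \in roots_of) :
  exists B, [/\ simple_graph B, connected_graph B &
                edge_dist A B <= #|roots_of|.-1].
Proof.
pose spoke x y := [&& x == z, y \in roots_of & y != z].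
pose f x y := [|| e x y, spoke x y | spoke y x].
pose B x := enum (f x).
have memB x y : (y \in B x) = f x y by rewrite mem_enum.
have fsym x y : f x y = f y x.
  by rewrite /f /adj (adj_sym compA); congr (_ || _); rewrite orbC.
exists B; split.
- split=> [u|u|u v]; first exact: enum_uniq; last by rewrite !memB fsym.
  rewrite memB /f /spoke /adj (negPf (adj_irr compA u)) /= orbb.
  by case: eqP; rewrite ?andbF.
- have conB x : connect (fun u v => v \in B u) x z.
    apply: (@connect_trans _ _ (root e x)).
      apply: connect_sub (connect_root e x) => u v uv.
      by apply: connect1; rewrite memB /f uv.
    have [->|rx] := eqVneq (root e x) z; first exact: connect0.
    have rr : root e x \in roots_of.
      by rewrite inE (root_root adj_connect_sym).
    by apply: connect1; rewrite memB /f /spoke eqxx rx rr !orbT.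
  have symB : connect_sym (fun u v => v \in B u).
    by apply: sym_connect_sym => u v; rewrite !memB fsym.
  by move=> x y; apply: connect_trans (conB x) _; rewrite symB.
have subAB : edges A \subset edges B.
  apply/subsetP=> _ /imset2P[x y _ xy ->]; apply/imset2P; exists x y => //.
  have{}xy : e x y by [].
  by rewrite memB /f xy.
rewrite /edge_dist (eqP (_ : edges A :\: edges B == set0)) ?setD_eq0 // set0U.
have -> : #|roots_of|.-1 = #|roots_of :\ z| by rewrite (cardsD1 z) rz.
apply: leq_trans (leq_imset_card (fun x => [set z; x]) _).
apply/subset_leq_card/subsetP=> s; rewrite inE => /andP[sA].
case/imset2P=> x y _ xy def_s; move: xy; rewrite memB /f => /or3P[xy|xy|xy].
- by case/negP: sA; rewrite def_s; apply/imset2P; exists x y.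
- move: xy => /and3P[/eqP xz yr yz]; apply/imsetP; exists y; last by rewrite def_s xz.
  by rewrite in_setD1 yz.
move: xy => /and3P[/eqP xz yr yz]; apply/imsetP; exists x; last by rewrite def_s xz setUC.
by rewrite in_setD1 yz.
Qed.

End Components.

(** * Graphs far from connected *)

Section Far.
Variables (R : realType) (p : params R) (n : nat) (G : erased_lists n).
Local Notation gap := (p_eps p - p_alpha p)%R.
Local Notation d := (p_deg p).
Hypotheses (gap_gt0 : (0 < gap)%R) (d_gt0 : (0 < d)%R).
Hypothesis avg : avg_degree R G = d.

(** For [n = 0] the division by zero gives average degree 0, against [d_gt0]. *)
Lemma avg_degree_gt0 : 0 < n.
Proof.
case: n G avg => // G0; rewrite /avg_degree invr0 mulr0 => def_d.
by move: d_gt0; rewrite -def_d ltxx.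
Qed.

Lemma sum_size_avg : ((\sum_x size (G x))%:R = n%:R * d :> R)%R.
Proof.
rewrite -avg /avg_degree /half_length mulrC [(2 * _)%R]mulrC !divfK ?pnatr_eq0 //.
by rewrite -lt0n avg_degree_gt0.
Qed.

(** A connected graph with an isolated vertex consists of that vertex alone and has average degree
    0; otherwise every degree is at least 1. *)
Lemma erased_connected_degree : erased_connected G -> (1 <= d)%R.
Proof.
move=> [A [compA conA]].
have n_gt0 : (0 < n%:R :> R)%R by rewrite ltr0n avg_degree_gt0.
rewrite -(ler_pM2l n_gt0) mulr1 -sum_size_avg ler_nat.
have [/forallP size_gt0|] := boolP [forall x, 0 < size (G x)].
  by rewrite -[leqLHS]card_ord -sum1_card; apply: leq_sum => x _.
rewrite negb_forall => /existsP[x]; rewrite -eqn0Ngt => /eqP size0.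
have defT : [set x] = setT.
  apply: (closed_connected conA (set11 x)) => y z /set1P-> xz.
  move: size0 xz; rewrite /adj (size_completion compA).
  by case: (A x).
have sum0 : \sum_x size (G x) = 0.
  rewrite (eq_bigl (mem [set x])) => [|y]; first by rewrite big_set1.
  by rewrite /= defT inE.
move: sum_size_avg; rewrite sum0 => /esym/eqP.
by rewrite mulf_eq0 !gt_eqF.
Qed.

Lemma component_convicting A r :
  completion G A -> #|component A r| < n ->
  \sum_(x in component A r) count_mem None (G x) < 2 ->
  small_degree p (\sum_(x in component A r) size (G x)) ->
  exists2 v, v \in component A r & convicting p G v.
Proof.
move=> compA ltKn lt2 small; have [v rv defK] := component_start compA lt2.
exists v; first by rewrite inE.
by rewrite /convicting defK small lt2 ltKn (component_sum_even compA).
Qed.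

(** Each component is found from one of its vertices, unless it has two erased
  entries, too many entries or too many vertices; the last three terms charge
  it for that. *)
Lemma component_charge A r :
  completion G A ->
  let K := component A r in
  let E := \sum_(x in K) count_mem None (G x) in
  let D := \sum_(x in K) size (G x) in
  (1 <= ((E < 2)%N && small_degree p D)%:R + E%:R / 2 + D%:R * (gap / 8)
        + #|K|%:R * (gap * d / 8))%R.
Proof.
move=> compA /=; set E := \sum_(x in _) count_mem _ _; set D := \sum_(x in _) size _.
set K := component A r.
have ge0_1 : (0 <= E%:R / 2 :> R)%R by rewrite divr_ge0.
have ge0_2 : (0 <= D%:R * (gap / 8))%R.
  by rewrite mulr_ge0 // divr_ge0 // ltW.
have ge0_3 : (0 <= #|K|%:R * (gap * d / 8))%R.
  by rewrite mulr_ge0 // divr_ge0 // mulr_ge0 // ltW.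
have [lt2|ge2] := ltnP E 2; last first.
  have : (2 <= E%:R :> R)%R by rewrite ler_nat.
  by move=> ?; rewrite add0r; lra.
case small_D: (small_degree p D) => /=; first lra.
move/negbT: small_D; rewrite /small_degree negb_and !negbK.
case/orP=> [gt64|gt8]; last lra.
(* If the total degree exceeds [(8 / beta) ^ 2], this square bound yields at least [8 / beta]
   vertices, and the last term alone reaches 1. *)
have le_D : (D%:R <= #|K|%:R ^+ 2 :> R)%R.
  by rewrite -natrX ler_nat (component_sum_le compA).
suff : (8 <= #|K|%:R * (gap * d))%R by lra.
have b_gt0 : (0 < gap * d)%R by rewrite mulr_gt0.
rewrite leNgt; apply/negP=> lt8.
move: gt64; rewrite ltNge => /negP[]; rewrite -mulrA.
apply: le_trans (ler_wpM2r _ le_D) _; first by rewrite mulr_ge0 // ltW.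
have -> : (64%:R = 8 ^+ 2 :> R)%R by rewrite -natrX.
rewrite -expr2 -exprMn lerXn2r ?nnegrE ?mulr_ge0 ?(ltW lt8) //; exact: ltW.
Qed.

Lemma many_convicting :
  alpha_erased (p_alpha p) G -> far_from_connected (p_eps p) G ->
  (n%:R * (gap * d / 4) <= #|[set v | convicting p G v]|%:R)%R.
Proof.
move=> [/andP[alpha_ge0 _] [A [compA le_erased]]] far.
have n_gt0 := avg_degree_gt0.
pose z := fingraph.root (adj A) (Ordinal n_gt0).
have zroot : z \in roots_of A by rewrite inE (root_root (adj_connect_sym compA)).
have [B [simB conB distB]] := edge_dist_star compA zroot.
have half : (half_length R G = n%:R * d / 2)%R by rewrite -sum_size_avg.
have roots_gt0 : 0 < #|roots_of A| by apply/card_gt0P; exists z.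
have le_roots : (p_eps p * (n%:R * d / 2) + 1 <= #|roots_of A|%:R)%R.
  have -> : (#|roots_of A|%:R = #|roots_of A|.-1%:R + 1 :> R)%R.
    by rewrite natr1 prednK.
  rewrite lerD2r -half.
  by apply: le_trans (far A B compA simB conB) _; rewrite ler_nat.
(* With at least two roots no component is the whole vertex set, as the condition [#|S| < n] of
   [convicting] demands. *)
have roots_gt1 : 1 < #|roots_of A|.
  rewrite -(ltr_nat R); apply: lt_le_trans le_roots.
  have eps_gt0 : (0 < p_eps p)%R by move: gap_gt0 alpha_ge0; lra.
  by rewrite ltrDr !mulr_gt0 ?invr_gt0 ?ltr0n.
have sum_erased : ((num_erased G)%:R <= p_alpha p * (n%:R * d))%R.
  apply: le_trans le_erased _; rewrite -sum_size_avg.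
  rewrite [(2 * _)%R]mulrC -mulrA ler_wpM2l // -natrM ler_nat mul2n.
  exact: card_edges_le.
pose good := [set r in roots_of A |
  (\sum_(x in component A r) count_mem None (G x) < 2) &&
  small_degree p (\sum_(x in component A r) size (G x))].
have le_good : #|good| <= #|[set v | convicting p G v]|.
  (* One convicting vertex is chosen in each good component; disjointness of the components makes
     the choice injective. *)
  pose f r := odflt r [pick v in component A r | convicting p G v].
  have f_good r : r \in good -> f r \in component A r /\ convicting p G (f r).
    rewrite inE => /and3P[rr lt2 small]; rewrite /f.
    case: pickP => [v /andP[]//|none].
    have ltKn : #|component A r| < n.
      rewrite -[ltnRHS]card_ord -cardsT; apply: proper_card.
      rewrite properE subsetT /=; apply/negP=> /subsetP fullK.
      have [x [y [xr yr /eqP[]]]] := card_gt1P roots_gt1.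
      move: (fullK x (in_setT x)) (fullK y (in_setT y)) xr yr.
      by rewrite !(componentP compA) !inE => /eqP-> /eqP-> /eqP<- /eqP<-.
    have [v vK cv] := component_convicting compA ltKn lt2 small.
    by have := none v; rewrite vK cv.
  rewrite -(card_in_imset (f := f) (D := good)) => [|r1 r2 g1 g2 eq_f].
    apply/subset_leq_card/subsetP=> _ /imsetP[r /f_good[_ ?] ->].
    by rewrite inE.
  have [] := f_good r1 g1; have [] := f_good r2 g2.
  rewrite eq_f !(componentP compA).
  move: g1 g2; rewrite !inE => /and3P[/eqP-> _ _] /and3P[/eqP-> _ _].
  by move=> /eqP-> _ /eqP.
(* The charges of [component_charge], summed over all components. *)
have : (#|roots_of A|%:R <= #|good|%:R + (num_erased G)%:R / 2
    + (\sum_x size (G x))%:R * (gap / 8) + n%:R * (gap * d / 8))%R.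
  have -> : (n%:R = (\sum_(x < n) 1)%N%:R :> R)%R by rewrite sum1_card card_ord.
  have -> : #|good| = \sum_(r in roots_of A) 
    ((\sum_(x in component A r) count_mem None (G x) < 2) &&
     small_degree p (\sum_(x in component A r) size (G x))).
    rewrite -sum1_card big_mkcond [RHS]big_mkcond; apply: eq_bigr => r _.
    by rewrite [r \in good]in_set; case: (r \in _) => //=; case: (_ && _).
  rewrite /num_erased -sum1_card -!(sum_components compA) !natr_sum !mulr_suml -!big_split /=.
  apply: ler_sum => r _; have := component_charge r compA.
  by rewrite /= sum1_card.
move: le_good; rewrite -(ler_nat R) => le_good.
(* In units of [n * d]: roots contribute at least [eps / 2], erasures cost at most [alpha / 2], and
   the two size terms cost [gap / 8] each, which leaves [gap / 4]. *)
rewrite sum_size_avg; lra.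
Qed.

End Far.

(** * Probability and parameters *)

Section Probability.
Variables (R : realType) (n t : nat).
Hypothesis n_gt0 : 0 < n.
Implicit Types E : t.-tuple 'I_n -> bool.

Lemma prob_predT E : (forall w, E w) -> prob R E = 1%R.
Proof.
move=> allE; rewrite /prob (_ : finset _ = setT); last first.
  by apply/setP=> w; rewrite !inE allE.
by rewrite cardsT card_tuple card_ord divff // pnatr_eq0 expn_eq0 gtn_eqF.
Qed.

Lemma prob_predC E : prob R (fun w => ~~ E w) = (1 - prob R E)%R.
Proof.
rewrite -(prob_predT (E := xpredT)) // /prob -mulrBl; congr (_ / _)%R.
apply/eqP; rewrite eq_sym subr_eq addrC -natrD eqr_nat.
rewrite -(cardsID [set w | E w] [set w | true]).
by apply/eqP; congr (_ + _); apply: eq_card => w; rewrite !inE ?andbT.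
Qed.

(** Viewed as functions, the tuples that avoid [P] in their first [T] places lie in a product with
    [T] factors [predC P] and [t - T] full factors. *)
Lemma prob_none T (P : pred 'I_n) : T <= t ->
  (prob R (fun w : t.-tuple 'I_n => ~~ has P (take T w))
     <= (1 - #|[set v | P v]|%:R / n%:R) ^+ T)%R.
Proof.
move=> le_T.
pose F (i : 'I_t) := if i < T then predC P else predT.
have le_card : #|[set w : t.-tuple 'I_n | ~~ has P (take T w)]| <=
    #|predC P| ^ T * n ^ (t - T).
  pose f (w : t.-tuple 'I_n) := [ffun i => tnth w i].
  have inj_f : injective f.
    by move=> w1 w2 /ffunP eq_f; apply: eq_from_tnth => i; have:= eq_f i; rewrite !ffunE.
  rewrite -(card_imset _ inj_f).
  have -> : #|predC P| ^ T * n ^ (t - T) = #|family F|.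
    rewrite card_family foldrE big_map big_enum /=.
    rewrite -(big_mkord xpredT (fun i => #|if i < T then predC P else predT|)).
    rewrite (big_cat_nat (leq0n T) le_T) /=; congr (_ * _).
      rewrite -[T in LHS]subn0 -prod_nat_const_nat.
      by apply: eq_big_nat => i /andP[_ ->].
    rewrite -prod_nat_const_nat; apply: eq_big_nat => i /andP[le_i _].
    by rewrite ltnNge le_i card_ord.
  apply/subset_leq_card/subsetP=> g /imsetP[w]; rewrite inE => noP ->.
  apply/familyP=> i; rewrite ffunE /F; case: ifP => // lt_i.
  apply: contra noP => Pi; apply/(has_nthP (tnth w i)); exists i.
    by rewrite size_take size_tuple; case: ifP.
  by rewrite nth_take // -tnth_nth.
have nR_gt0 : (0 < n%:R :> R)%R by rewrite ltr0n.
rewrite /prob ler_pdivrMr ?ltr0n ?expn_gt0 ?n_gt0 //.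
have -> : (1 - #|[set v | P v]|%:R / n%:R = #|predC P|%:R / n%:R :> R)%R.
  rewrite -[X in (X - _)%R](divff (lt0r_neq0 nR_gt0)) -mulrBl; congr (_ / _)%R.
  apply/eqP; rewrite subr_eq addrC -natrD eqr_nat; apply/eqP.
  by rewrite -[LHS]card_ord -(cardC P) cardsE.
move: le_card; rewrite -(ler_nat R) => /le_trans; apply.
rewrite natrM !natrX -[t in leRHS](subnK le_T) exprD expr_div_n.
by rewrite mulrCA divfK ?expf_neq0 ?lt0r_neq0 // mulrC.
Qed.

End Probability.

(** * Numerical estimates for the failure probability and the running time *)

Lemma expr_le_third (R : realFieldType) (x : R) T :
  (0 <= x <= 1)%R -> (2 <= T%:R * x)%R -> ((1 - x) ^+ T <= 1 / 3)%R.
Proof.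
case/andP=> x_ge0 x_le1 Tx.
have bernoulli k : ((1 - x) ^+ k * (1 + k%:R * x) <= 1)%R.
  elim: k => [|k]; first by rewrite expr0 mul0r addr0 mulr1.
  apply: le_trans; rewrite exprSr -mulrA ler_wpM2l ?exprn_ge0 ?subr_ge0 //.
  rewrite -natr1; have := ler0n R k; nra.
have := bernoulli T; have : (0 <= (1 - x) ^+ T)%R by rewrite exprn_ge0 ?subr_ge0.
by set y := ((1 - x) ^+ T)%R; nra.
Qed.

Lemma round_count (R : realType) (b : R) : (0 < b)%R ->
  exists T, (forall r, (r%:R * b < 8%:R)%R = (r < T)) /\ (T%:R * b <= 8 + b)%R.
Proof.
move=> b_gt0.
have exT : exists r, (8%:R <= r%:R * b)%R.
  exists (Num.bound (8%:R / b)); rewrite -ler_pdivrMr //.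
  by apply/ltW/archi_boundP; rewrite divr_ge0 // ltW.
case: (ex_minnP exT) => T le8 minT; exists T; split.
  move=> r; apply/idP/idP => [|lt_r].
    by rewrite ltNge ltnNge; apply: contra => le_T; apply: le_trans le8 _;
       rewrite ler_pM2r // ler_nat.
  by rewrite ltNge; apply/negP=> /minT; rewrite leqNgt lt_r.
case: T le8 minT => [|T] le8 minT; first by rewrite mul0r addr_ge0 // ltW.
rewrite -natr1 mulrDl mul1r lerD2r leNgt; apply/negP=> /ltW/minT.
by rewrite ltnn.
Qed.

(** The largest admissible total degree is taken because the time estimate uses both degree bounds
    for [L] itself. *)
Lemma small_degree_max (R : realType) (p : params R) :
  (0 < p_eps p - p_alpha p)%R ->
  exists L, small_degree p L /\ forall D, small_degree p D -> D <= L.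
Proof.
move=> gap_gt0.
have ex0 : exists D, small_degree p D.
  by exists 0; rewrite /small_degree !mul0r -!leNgt !ler0n.
have bounded D : small_degree p D -> D <= Num.bound (8%:R / (p_eps p - p_alpha p))%R.
  case/andP=> _; rewrite -leNgt -ler_pdivlMr // => le8.
  rewrite -(ler_nat R); apply: le_trans le8 _; apply/ltW/archi_boundP.
  by rewrite divr_ge0 // ltW.
by case: (ex_maxnP ex0 bounded) => L smallL maxL; exists L.
Qed.

Lemma le_complexity_bound (R : realType) (d eps alpha C x : R) :
  (0 < d)%R -> (0 < eps - alpha)%R ->
  (x * ((eps - alpha) ^+ 2 * d) <= C)%R ->
  (x * ((eps - alpha) ^+ 2 * d) * ((eps - alpha) * d ^+ 2) <= C)%R ->
  (x <= C * complexity_bound d eps alpha)%R.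
Proof.
move=> d_gt0 gap_gt0 le1 le2; rewrite /complexity_bound.
have a_gt0 : (0 < (eps - alpha) ^+ 2 * d)%R by rewrite mulr_gt0 ?exprn_gt0.
have b_gt0 : (0 < (eps - alpha) * d ^+ 2)%R by rewrite mulr_gt0 ?exprn_gt0.
rewrite !div1r mulrA; case: (leP _^-1%R 1%R) => _; last by rewrite mulr1 ler_pdivlMr.
by rewrite -mulrA -invfM ler_pdivlMr ?mulr_gt0 // mulrA.
Qed.

Lemma complexity_bound_ge0 (R : realType) (d eps alpha : R) :
  (0 < d)%R -> (0 < eps - alpha)%R -> (0 <= complexity_bound d eps alpha)%R.
Proof.
by move=> d_gt0 gap_gt0; rewrite -[leRHS]mul1r le_complexity_bound // !mul0r.
Qed.

Lemma steps_bound (R : realType) (d gap : R) (T L : nat) :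
  (1 <= d)%R -> (0 < gap)%R -> (gap * d <= 2)%R ->
  (T%:R * (gap * d) <= 8 + gap * d)%R ->
  (L%:R * (gap * d) * (gap * d) <= 64)%R -> (L%:R * gap <= 8)%R ->
  let t := ((T * (80 * L + 81) + 5)%N%:R : R)%R in
  (t * (gap ^+ 2 * d) <= 300 * 300)%R /\
  (t * (gap ^+ 2 * d) * (gap * d ^+ 2) <= 300 * 300)%R.
Proof.
move=> d_ge1 gap_gt0; move def_b: (gap * d)%R => b b_le2 leT le64 le8 t.
have gap_le : (gap <= b)%R by rewrite -def_b ler_peMr // ltW.
have b_gt0 : (0 < b)%R := lt_le_trans gap_gt0 gap_le.
have leT10 : (T%:R * b <= 10)%R by lra.
have T_ge0 : (0 <= T%:R * b)%R by rewrite mulr_ge0 // ltW.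
have def_t : t = (T%:R * (80 * L%:R + 81) + 5)%R by rewrite /t natrD natrM natrD natrM.
have L_ge0 := ler0n R L.
(* Both estimates are instances: [c = gap] uses [L * gap <= 8], and [c = b * b] uses
   [L * b * b <= 64]. The number 5444 below is [80 * 64 + 81 * 4]. *)
have bound (c : R) : (0 <= c)%R -> (c <= 4)%R -> (L%:R * c <= 64)%R ->
    (t * (b * c) <= 300 * 300)%R.
  move=> c_ge0 c_le4 Lc.
  have -> : (t * (b * c) = (T%:R * b) * (80 * (L%:R * c) + 81 * c) + 5 * (b * c))%R.
    by rewrite def_t; ring.
  have le1 : (80 * (L%:R * c) + 81 * c <= 5444)%R by lra.
  have ge0 : (0 <= 80 * (L%:R * c) + 81 * c)%R.
    by rewrite addr_ge0 // !mulr_ge0.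
  have le2 : ((T%:R * b) * (80 * (L%:R * c) + 81 * c) <= 10 * 5444)%R by apply: ler_pM.
  have le3 : (b * c <= 2 * 4)%R by apply: ler_pM => //; apply: ltW.
  lra.
split.
  have -> : (gap ^+ 2 * d = b * gap)%R by rewrite -def_b; ring.
  by apply: bound; lra.
have -> : (t * (gap ^+ 2 * d) * (gap * d ^+ 2) = t * (b * (b * b)))%R by rewrite -def_b; ring.
apply: bound; rewrite ?mulr_ge0 ?(ltW b_gt0) ?mulrA //.
have -> : (4 = 2 * 2 :> R)%R by rewrite -natrM.
by rewrite ler_pM ?(ltW b_gt0).
Qed.

Unset Implicit Arguments.
Set Strict Implicit.
Set Printing Implicit Defensive.

(* [complexity_bound] is bounded away from 0 for d >= 1 but not for d < 1, and
   any run takes at least one step: hence the maximum with 1 in the time. *)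
Theorem theorem1p2 (R : realType) :
  exists (P : cmd) (C : R), (0 < C)%R /\
  forall (n : nat) (d eps alpha : R),
    (0 < d)%R -> (0 < eps < 2 / d)%R -> (0 <= alpha < eps)%R ->
    exists t q : nat,
      [/\ (q%:R <= C * complexity_bound d eps alpha)%R,
          (t%:R <= C * Num.max 1 (complexity_bound d eps alpha))%R,
          forall G : erased_lists n,
            alpha_erased alpha G -> avg_degree R G = d ->
            runs_within (Params d eps alpha) G P t q,
          connectedness_tester P t n d eps alpha &
          one_sided P t n d eps alpha].
Proof.
exists tester, (300 * 300)%R; split; first by rewrite mulr_gt0.
move=> n d eps alpha d_gt0 /andP[eps_gt0 eps_lt] /andP[alpha_ge0 alpha_lt].
set p := Params d eps alpha.
have gap_gt0 : (0 < p_eps p - p_alpha p)%R by rewrite subr_gt0.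
have cb_ge0 : (0 <= complexity_bound d eps alpha)%R by apply: complexity_bound_ge0.
(* For [d < 1] no input is connected: rejecting after two steps and no query is correct, and
   one-sidedness is vacuous. *)
have [d_lt1|d_ge1] := ltP d 1%R.
  have run2 G (w : 2.-tuple 'I_n) := run_tester_sparse (p := p) G w d_lt1 (ltnSn 1).
  have disconnected G : avg_degree R G = d -> ~ @erased_connected n G.
    move=> avg /(@erased_connected_degree R p n G d_gt0 avg) /=.
    by rewrite leNgt d_lt1.
  exists 2, 0; split.
  - by rewrite mulr_ge0 // mulr_ge0.
  - have : (1 <= Num.max 1 (complexity_bound d eps alpha))%R by rewrite le_max lexx.
    by move=> ?; lra.
  - by move=> G _ _ w; rewrite run2.
  - move=> G _ avg; split=> [/(disconnected G avg)//|_].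
    have n_gt0 := avg_degree_gt0 (p := p) d_gt0 avg.
    rewrite /reject_prob prob_predT // => [|w]; last by rewrite run2.
    by lra.
  by move=> G _ avg /(disconnected G avg).
have b_le2 : ((eps - alpha) * d <= 2)%R.
  apply: le_trans (_ : (eps * d <= 2)%R); last by rewrite -ler_pdivlMr // ltW.
  by rewrite ler_pM2r // gerBl.
have b_gt0 : (0 < (eps - alpha) * d)%R by rewrite mulr_gt0.
have [T [lt_T leT]] := round_count b_gt0.
have [L [smallL maxL]] := small_degree_max gap_gt0.
set t := (T * (80 * L + 81) + 5).
have T_le_t : T <= t by rewrite (leq_trans _ (leq_addr _ _)) ?leq_pmulr ?addn_gt0 ?orbT.
have runs G (w : t.-tuple 'I_n) : 
    halted (run p G tester t w) /\
    accepting (run p G tester t w) = ~~ has (convicting p G) (take T w).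
  apply: (run_tester G maxL (ltW gap_gt0) (ltW d_gt0) lt_T) => //.
  by rewrite size_tuple.
have t_le : (t%:R <= 300 * 300 * complexity_bound d eps alpha)%R.
  have /andP[] := smallL; rewrite -!leNgt => le64 le8.
  have [le1 le2] := steps_bound d_ge1 gap_gt0 b_le2 leT le64 le8.
  exact: le_complexity_bound.
have accepts (G : erased_lists n) : alpha_erased alpha G -> avg_degree R G = d ->
    erased_connected G -> accept_prob p G tester t = 1%R.
  move=> _ avg [A [compA conA]].
  apply: prob_predT (avg_degree_gt0 (p := p) d_gt0 avg) _ _ => w.
  have [_ ->] := runs G w; apply/hasPn => v _.
  exact: convicting_disconnected conA.
exists t, t; split=> //.
- apply: le_trans t_le _; rewrite ler_wpM2l ?mulr_ge0 // le_max lexx orbT //.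
- move=> G _ _ w; split; first by have [] := runs G w.
  exact: (queries_iter_step p G t ([:: tester], _)).
move=> G erG avg; split=> [conG|far].
  by rewrite (accepts G) //; lra.
have n_gt0 := avg_degree_gt0 (p := p) d_gt0 avg.
have -> : reject_prob p G tester t =
    prob R (fun w : t.-tuple 'I_n => ~~ ~~ has (convicting p G) (take T w)).
  rewrite /reject_prob /prob; congr (_%:R / _)%R; apply: eq_card => w.
  rewrite !inE; have [haltw <-] := runs G w.
  by rewrite /rejecting /accepting haltw.
rewrite prob_predC //.
pose x : R := (#|[set v | convicting p G v]|%:R / n%:R)%R.
have nR_gt0 : (0 < n%:R :> R)%R by rewrite ltr0n.
have x_ge : ((eps - alpha) * d / 4 <= x)%R.
  by rewrite ler_pdivlMr // mulrC; apply: (many_convicting gap_gt0 d_gt0 avg).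
have x_le1 : (x <= 1)%R.
  by rewrite ler_pdivrMr // mul1r ler_nat -[leqRHS]card_ord max_card.
(* A random vertex convicts with probability [x] at least [beta / 4], and [T] is at least
   [8 / beta]. *)
have Tx : (2 <= T%:R * x)%R.
  have := lt_T T; rewrite ltnn => /negbT; rewrite -leNgt => le8.
  apply: le_trans (ler_wpM2l (ler0n R T) x_ge); lra.
have third := expr_le_third (T := T) (x := x).
have none := prob_none R n_gt0 (convicting p G) T_le_t.
have : (prob R (fun w : t.-tuple 'I_n => ~~ has (convicting p G) (take T w)) <= 1 / 3)%R.
  apply: le_trans none _; apply: third => //.
  by rewrite x_le1 divr_ge0.
lra.
Qed.
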